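(* Let $\kappa$ be a cardinal and let $\mathcal{F}_\alpha$ be filters on $\omega$ for $\alpha\in\kappa$. If $\prod_{\alpha\in\kappa}\mathcal{F}_\alpha$ (with the product topology) is countable dense homogeneous, then $\kappa<\mathfrak{p}$ and each $\mathcal{F}_\alpha$ is a non-meager $\mathsf{P}$-filter.
   Context: A filter (on $\omega$) is a collection $\mathcal{F}\subseteq\mathcal{P}(\omega)$ such that $\varnothing\notin\mathcal{F}$, $\omega\in\mathcal{F}$; if $x\in\mathcal{F}$ and $y\subseteq\omega$ differs from $x$ by a finite set then $y\in\mathcal{F}$; $\mathcal{F}$ is closed upward under inclusion; and $\mathcal{F}$ is closed under finite intersections. Subsets of $\omega$ are identified with their characteristic functions, so every filter carries the subspace topology of $2^\omega$; a filter is non-meager if it is a non-meager subset of $2^\omega$. A pseudointersection of $\mathcal{X}\subseteq\mathcal{P}(\omega)$ is an infinite $z\subseteq\omega$ with $z\setminus x$ finite for all $x\in\mathcal{X}$. A filter $\mathcal{F}$ is a $\mathsf{P}$-filter if every countable $\mathcal{X}\subseteq\mathcal{F}$ has a pseudointersection in $\mathcal{F}$. A space $X$ is countable dense homogeneous if $X$ is separable and for every pair $(D,E)$ of countable dense subsets of $X$ there is a homeomorphism $h:X\to X$ with $h[D]=E$. $\mathfrak{p}$ denotes the pseudointersection number. *)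

(* Defs.v *)
From mathcomp Require Import all_boot finmap.
From mathcomp Require Import all_classical topology cantor.

Set Implicit Arguments.
Unset Strict Implicit.
Unset Printing Implicit Defensive.

Local Open Scope classical_set_scope.
Local Open Scope card_scope.

Section topological_notions.
Context {T : topologicalType}.

Definition nowhere_dense (A : set T) := (closure A)° = set0.

Definition meager (A : set T) :=
  exists2 N : nat -> set T, (forall n, nowhere_dense (N n)) & A = \bigcup_n N n.

Definition countable_dense (D : set T) := countable D /\ dense D.

Definition homeomorphism (h : T -> T) :=
  continuous h /\ exists k : T -> T, [/\ continuous k, cancel h k & cancel k h].

End topological_notions.

Definition countable_dense_homogeneous (T : topologicalType) :=
  (exists D : set T, countable_dense D) /\
  forall D E : set T, countable_dense D -> countable_dense E ->
    exists2 h : T -> T, homeomorphism h & h @` D = E.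

Definition pseudointersection (X : set (set nat)) (z : set nat) :=
  infinite_set z /\ forall x, X x -> finite_set (z `\` x).

(* mathcomp's [ProperFilter] does not require the cofinite sets to belong
   to the filter; this is the role of the closure under finite changes. *)
Definition omega_filter (F : set (set nat)) :=
  ProperFilter F /\
  forall x y, F x -> finite_set (x `\` y) -> finite_set (y `\` x) -> F y.

Definition P_filter (F : set (set nat)) :=
  omega_filter F /\
  forall X, X `<=` F -> countable X -> exists2 z, F z & pseudointersection X z.

(* A family of subsets of nat, as a set of characteristic functions. *)
Definition char_funs (F : set (set nat)) : set cantor_space :=
  [set x | F [set n | x n]].

Definition filter_space (F : set (set nat)) : topologicalType :=
  set_type (char_funs F).

Definition nonmeager_filter (F : set (set nat)) :=
  omega_filter F /\ ~ meager (char_funs F).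

Definition strong_fip (X : set (set nat)) :=
  forall Y, Y `<=` X -> finite_set Y -> infinite_set (\bigcap_(y in Y) y).

Definition sfip_without_pi (X : set (set nat)) :=
  strong_fip X /\ ~ exists z, pseudointersection X z.

Definition card_lt T U (A : set T) (B : set U) := (A #<= B) && ~~ (B #<= A).

Lemma exists_card_min (T : Type) (C : set (set T)) :
  C !=set0 -> exists2 X, C X & forall Y, C Y -> X #<= Y.
Proof.
move=> C0.
pose J := {Y : set T | C Y}.
pose P (S : set (J -> T)) := (forall f j, S f -> sval j (f j)) /\
  forall f g j, S f -> S g -> f j = g j -> f = g.
have [|S [PS Smax]] := @Zorn_bigcup _ P.
  move=> K KP totK; split.
    by move=> f j [S KS Sf]; have [+ _] := KP _ KS; apply.
  move=> f g j [S KS Sf] [S' KS' S'g].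
  have [SS'|S'S] := totK _ _ KS KS'.
    by have [_ +] := KP _ KS'; apply => //; exact: SS'.
  by have [_ +] := KP _ KS; apply => //; exact: S'S.
have [[j jS]|nj] := pselect (exists j : J,
    forall t, sval j t -> exists2 f, S f & f j = t).
  exists (sval j); first by case: (j).
  move=> Y CY; pose k : J := exist _ Y CY.
  have [inS injS] := PS.
  have leS : sval j #<= S.
    have -> : sval j = (fun f : J -> T => f j) @` S.
      apply/seteqP; split=> [t /jS [f Sf <-]|t [f Sf <-]]; first by exists f.
      exact: inS.
    exact: card_image_le.
  apply: card_le_trans leS _.
  have : $|{injfun S >-> Y}|.
    apply/injfunPex; exists (fun f => f k); first by move=> f /(inS _ k).
    by move=> f g; rewrite !inE => Sf Sg /injS; apply.
  by case=> f; exact: inj_card_le f.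
have {}nj j : exists t, sval j t /\ ~ exists2 f, S f & f j = t.
  apply: contrapT => H; apply: nj; exists j => t jt.
  by apply: contrapT => H'; apply: H; exists t.
have [e eP] := choice nj.
have [Y0 CY0] := C0.
have nSe : ~ S e.
  by move=> Se; have [_] := eP (exist _ Y0 CY0); apply; exists e.
exfalso; apply: (Smax (e |` S)).
  by split=> [f Sf|H]; [right|apply: nSe; apply: H; left].
have [inS injS] := PS; split.
  by move=> f j [->|/inS]; [case: (eP j)|exact].
move=> f g j [->|Sf] [->|Sg] // fg.
- by have [_] := eP j; case; exists g.
- by have [_] := eP j; case; exists f.
- exact: injS Sf Sg fg.
Qed.

Lemma exists_sfip_without_pi : exists X, sfip_without_pi X.
Proof.
have [U [UU sU]] := @ultraFilterLemma nat \oo _.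
have inf x : U x -> infinite_set x.
  move=> Ux /finite_seqP [A xA].
  have Ucx : U (~` x).
    apply: sU; exists (\max_(i <- A) i).+1 => // n /= ltn; rewrite xA /= => nA.
    have := @leq_bigmax_seq _ A xpredT (fun i => i) n nA isT.
    by rewrite leqNgt ltn.
  apply: (@filter_not_empty _ U _).
  by rewrite -(setICr x); exact: filterI.
exists U; split.
  move=> Y YU /finite_fsetP [A YA]; apply: inf; rewrite YA.
  by apply: filter_bigI => y yA; apply: YU; rewrite YA.
move=> [z [zinf zU]].
have [g gz ginj] : exists2 g : nat -> nat, (forall n, z (g n)) & injective g.
  move: zinf => /infiniteP /pcard_leP [g]; exists g.
    by move=> n; apply: funS.
  by move=> m n; apply: inj; rewrite inE.
have infg (h : nat -> nat) : injective h ->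
    infinite_set [set g (h n) | n in [set: nat]].
  move=> hinj; apply/infiniteP.
  have i : {in [set: nat] &, injective (g \o h)} by move=> m n _ _ /ginj /hinj.
  by have /card_eqPle [] := inj_card_eq i.
pose E := [set g n.*2 | n in [set: nat]].
have [/zU|/zU] := in_ultra_setVsetC E UU.
  apply: sub_infinite_set (infg (fun n => n.*2.+1) _)
    => [_ [n _ <-]|m n [] /double_inj //].
  split=> // -[m _ /ginj /(congr1 odd)] /=.
  by rewrite !odd_double.
apply: sub_infinite_set (infg double double_inj) => _ [n _ <-].
by split=> //; apply; exists n.
Qed.

Lemma exists_pseudointersection_number :
  exists2 X, sfip_without_pi X & forall Y, sfip_without_pi Y -> X #<= Y.
Proof. exact: exists_card_min exists_sfip_without_pi. Qed.

(* There is no type of cardinals; p is represented by a family of that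
   cardinality, namely one of least cardinality having the strong finite
   intersection property and no pseudointersection. *)
Definition frakp : set (set nat) :=
  sval (cid2 exists_pseudointersection_number).

Lemma frakpP :
  sfip_without_pi frakp /\ forall Y, sfip_without_pi Y -> frakp #<= Y.
Proof. by rewrite /frakp; case: cid2. Qed.

(* Main.v *)
(* Being countable dense homogeneous forces every isomorphism-invariant property
   of countable dense sets, once true of one of them and preserved by enlarging
   the set, to hold for all of them. Two such properties are used.

   Containing a nontrivial convergent sequence: some countable dense set has
   it. If [frakp #<= [set: K]], index by K a family y with the strong finite
   intersection property and no pseudointersection. The points e(n,k), n <= k,
   whose coordinate b is that of the n-th point of a countable dense set if k is
   in y b, and [k, oo) otherwise, form a dense set, since finitely many
   coordinates are left untouched for infinitely many k. On a convergent
   sequence of such points some coordinate b would be [k, oo) for arbitrarily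
   large k, so its limit would be empty.

   Having a nonempty crowded subset with compact closure: some countable dense
   set has it, because the product contains a Cantor set unless it is countable.
   Given x_n in F a and f, replace coordinate a of the n-th point of a dense
   sequence, from n on, by the part of x_n above f n. In a crowded subset of the
   result, two interleaved sequences have limits in F a whose intersection w
   avoids infinitely many blocks [n, f n) and lies in x_n in between. The
   latter gives P-filters, the former non-meagerness by Talagrand's argument. *)

Require Import Defs.
From mathcomp Require Import all_boot finmap.
From mathcomp Require Import all_classical topology cantor.

Set Implicit Arguments.
Unset Strict Implicit.
Unset Printing Implicit Defensive.

Local Open Scope classical_set_scope.
Local Open Scope card_scope.

(** * Convergence in product topologies, and enumeration of countable sets *)

Lemma cvg_initialP (S : choiceType) (T : topologicalType) (f : S -> T)
    (G : set_system S) (s : S) : Filter G ->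
  G --> (s : initial_topology f) <-> f @ G --> f s.
Proof.
move=> FG; split=> [Gs|Gfs].
  by apply: cvg_trans (cvg_app f Gs) _; exact: initial_continuous.
move=> A [_ /= [[B oB <-] Bfs BA]]; rewrite nbhs_filterE.
by apply: filterS BA _; apply: Gfs; exact: open_nbhs_nbhs.
Qed.

Lemma cvg_prodP (I : Type) (T : I -> topologicalType)
    (G : set_system (prod_topology T)) (p : prod_topology T) : Filter G ->
  G --> p <-> forall i, (fun q : prod_topology T => q i) @ G --> p i.
Proof.
by move=> FG; rewrite cvg_sup; split=> Gp i; exact/cvg_initialP/Gp.
Qed.

Lemma filter_finite_bigcap (I T : Type) (G : set_system T) (S : set I)
    (P : I -> set T) : Filter G -> finite_set S ->
  (forall i, S i -> G (P i)) -> G (\bigcap_(i in S) P i).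
Proof.
move=> FG /(@finite_fsetP {classic I}) [A ->] GP.
exact: (@filter_bigI _ {classic I}).
Qed.

Lemma cvg_cantorP (G : set_system cantor_space) (x : cantor_space) : Filter G ->
  G --> x <-> forall k, \forall y \near G, y k = x k.
Proof.
move=> FG; rewrite (@cvg_prodP _ (fun=> bool)); split=> Gx k.
  exact: (Gx k _ (discrete_set1 _)).
by apply/discrete_cvg; exact: Gx.
Qed.

Lemma countable_range_of (T : Type) (D : set T) : countable D -> D !=set0 ->
  exists u : nat -> T, range u = D.
Proof.
elim/Ppointed: T => T in D *; first by move=> _ [x]; case: (no x).
move=> /pcard_surjP [g gs] [x0 Dx0].
exists (fun n => if pselect (D (g n)) then g n else x0).
apply/seteqP; split=> [_ [n _ <-]|y /[dup] Dy /gs [n _ gn]].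
  by case: pselect.
by exists n => //; rewrite gn; case: pselect.
Qed.

Lemma countable_setU (T : Type) (A B : set T) :
  countable A -> countable B -> countable (A `|` B).
Proof.
by move=> cA cB; rewrite -bigcup2E; apply: bigcup_countable => // -[|[|i]].
Qed.

(** The compact [C] stands for the closure of [Q]; it may leave [D], since it only has to supply
    cluster points for sequences from [Q]. *)
Definition compactly_crowded {T : topologicalType} (D : set T) :=
  exists Q C : set T,
    [/\ Q `<=` D, Q !=set0, Q `<=` limit_point Q, compact C & Q `<=` C].

(** One property serves both conclusions: the gaps [[m i, f (m i))] missed by [w] give
    non-meagerness, and the inclusion in [x (m i)] on the rest of each block gives
    pseudointersections. *)
Definition block_selective (G : set (set nat)) :=
  forall (f : nat -> nat) (x : nat -> set nat),
  (forall n, n < f n) -> (forall n, G (x n)) ->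
  exists m : nat -> nat, exists w : set nat, [/\ G w,
    forall i, f (m i) <= m i.+1 &
    forall i j, m i <= j < m i.+1 -> w j -> f (m i) <= j /\ x (m i) j].

(** * Products of filters in coordinates, and block selection from crowded sets *)

Section product_of_filters.
Context {K : Type} (F : K -> set (set nat)).

Local Notation X := (prod_topology (fun a : K => filter_space (F a))).

Definition coord (p : X) (a : K) : nat -> bool := set_val (p a).

Lemma coordP p a : F a [set k | coord p a k].
Proof. by have := set_valP (p a). Qed.

Definition point_of (p : K -> nat -> bool)
    (pF : forall a, F a [set k | p a k]) : X :=
  fun a => SigSub (mem_set (pF a : char_funs (F a) (p a))).

Lemma coord_point_of p pF a : coord (@point_of p pF) a = p a.
Proof. by []. Qed.

Lemma eq_coord (p q : X) : (forall a k, coord p a k = coord q a k) -> p = q.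
Proof.
move=> pq; apply: functional_extensionality_dep => a.
by apply/val_inj/funext => k; exact: pq.
Qed.

Lemma cvg_coordP (G : set_system X) (p : X) : Filter G ->
  G --> p <-> forall a k, \forall q \near G, coord q a k = coord p a k.
Proof.
move=> FG; rewrite cvg_prodP; split=> Gp a.
  by have /cvg_initialP/cvg_cantorP := Gp a.
by apply/cvg_initialP/cvg_cantorP => k; exact: Gp.
Qed.

Lemma nbhs_coord (p : X) (S : set K) N : finite_set S ->
  nbhs p [set q | forall a k, S a -> k < N -> coord q a k = coord p a k].
Proof.
move=> fS.
have /cvg_coordP near_p : nbhs p --> p by [].
pose P (ak : K * nat) := [set q | coord q ak.1 ak.2 = coord p ak.1 ak.2].
have : nbhs p (\bigcap_(ak in S `*` `I_N) P ak).
  by apply: filter_finite_bigcap => [|ak _];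
    [exact: finite_setX|exact: near_p].
by apply: filterS => q Pq a k Sa kN; apply: (Pq (a, k)).
Qed.

(** The boxes around [p] generate a filter that converges to [p] by [cvg_coordP], so every
    neighbourhood contains a box. *)
Lemma nbhs_coordP (p : X) (U : set X) : nbhs p U ->
  exists S N, finite_set S /\
    forall q, (forall a k, S a -> k < N -> coord q a k = coord p a k) -> U q.
Proof.
pose G := filter_from [set SN : set K * nat | finite_set SN.1]
  (fun SN => [set q : X | forall a k, SN.1 a -> k < SN.2 ->
    coord q a k = coord p a k]).
have FG : Filter G.
  apply: filter_from_filter; first by exists (set0, 0); exact: finite_set0.
  move=> [S N] [S' N'] /= fS fS'; exists (S `|` S', maxn N N') => /=.
    by rewrite finite_setU.
  move=> q pq; split=> a k Sa kN; apply: pq; rewrite ?leq_max ?kN ?orbT //.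
  - by left.
  - by right.
have Gp : G --> p.
  apply/cvg_coordP => a k; exists ([set a], k.+1) => //= q; exact.
by move=> /Gp [[S N]] /= fS SNU; exists S, N; split.
Qed.

Lemma dense_coordP (D : set X) : dense D <->
  forall (p : X) (S : set K) N, finite_set S ->
    exists2 d, D d & forall a k, S a -> k < N -> coord d a k = coord p a k.
Proof.
split=> [dD p S N fS|dD U [p Up] oU].
  have := nbhs_coord p N fS; rewrite nbhsE => -[O [oO Op] OS].
  by have [|d [/OS dp Dd]] := dD O _ oO; [exists p|exists d].
have [S [N [fS SNU]]] := nbhs_coordP (open_nbhs_nbhs (conj oU Up)).
by have [d Dd /SNU Ud] := dD p S N fS; exists d.
Qed.


(** Crowdedness approximates each point of [Q], in coordinate [a], by points of [Q] of large index;
    compactness puts the limits of the resulting sequences in [F a]. *)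
Lemma filter_branches a (e : nat -> X) (f : nat -> nat) :
  omega_filter (F a) -> (forall n, n < f n) -> compactly_crowded (range e) ->
  exists m : nat -> nat, exists w : set nat, [/\ F a w,
    forall i, f (m i) <= m i.+1 &
    forall i j, m i <= j < m i.+1 -> w j -> coord (e (m i)) a j].
Proof.
move=> [FF _] ltf [Q [C [QE [q0 Qq0] Qlim cC QC]]].
have next n l : exists n', Q (e n) -> [/\ Q (e n'), l <= n' &
    forall j, j < l -> coord (e n') a j = coord (e n) a j].
  have [Qn|nQ] := pselect (Q (e n)); last by exists 0.
  (* This neighbourhood excludes the points of index below [l] other than [e n], so a point of it
     distinct from [e n] can only have indices at least [l]. *)
  have near_n : nbhs (e n)
      (\bigcap_(i in `I_l) [set q | e i <> e n -> q <> e i]).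
    apply: filter_finite_bigcap => // i _.
    have [<-|ein] := pselect (e i = e n); first by apply: filterE => q /(_ erefl).
    have [b [k /eqP bk]] : exists b k, coord (e i) b k <> coord (e n) b k.
      apply: contrapT => H; apply: ein; apply: eq_coord => b k.
      by apply: contrapT => bk; apply: H; exists b, k.
    have := nbhs_coord (e n) k.+1 (finite_set1 b).
    apply: filterS => q qn _ qi; move: bk.
    by rewrite -qi qn // eqxx.
  have near_a := nbhs_coord (e n) l (finite_set1 a).
  have [y [/eqP nq Qy [Uy Vy]]] := Qlim _ Qn _ (filterI near_n near_a).
  have [n' _ yE] := QE _ Qy; subst y.
  exists n' => _; split=> [//| |j jl]; last exact: Vy.
  by rewrite leqNgt; apply/negP => n'l; apply: (Uy n' n'l).
have [nx nxP] := choice (fun nl : nat * nat => next nl.1 nl.2).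
have {}nxP n l : Q (e n) -> [/\ Q (e (nx (n, l))), l <= nx (n, l) &
    forall j, j < l -> coord (e (nx (n, l))) a j = coord (e n) a j].
  exact: (nxP (n, l)).
have [n0 _ en0] := QE _ Qq0.
(* m i.+2 approximates m i up to f (m i.+1), so that each of the two limits z 0
   and z 1 agrees with coord (e (m i)) a on the block [m i, m i.+1), for the
   i of its own parity: together they control all blocks. *)
pose st i := iter i (fun uv : nat * nat => (uv.2, nx (uv.1, f uv.2)))
  (n0, nx (n0, f n0)).
pose m i := (st i).1.
have mS i : m i.+2 = nx (m i, f (m i.+1)) by [].
have m1 : m 1 = nx (m 0, f (m 0)) by [].
have Q0 : Q (e (m 0)) by rewrite /m /= en0.
have Qm i : Q (e (m i)) /\ Q (e (m i.+1)).
  elim: i => [|i [IH IH']]; split=> //.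
    by rewrite m1; case: (nxP _ (f (m 0)) Q0).
  by rewrite mS; case: (nxP _ (f (m i.+1)) IH).
have fm i : f (m i) <= m i.+1.
  case: i => [|i]; first by rewrite m1; case: (nxP _ (f (m 0)) Q0).
  by rewrite mS; case: (nxP _ (f (m i.+1)) (Qm i).1).
have ltm i : m i < m i.+1 by exact: leq_trans (ltf _) (fm _).
have gem i : i <= m i by elim: i => // i IH; exact: leq_ltn_trans IH (ltm i).
have mono : {homo m : i j / i <= j} 
  by apply: homo_leq => [//|? ? ?|i]; [exact: leq_trans|exact: ltnW].
have agree i j : j < m i.+1 -> coord (e (m i.+2)) a j = coord (e (m i)) a j.
  move=> jm; rewrite mS; case: (nxP _ (f (m i.+1)) (Qm i).1) => _ _; apply.
  exact: ltn_trans jm (ltf _).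
have stable i k j : j < m i.+1 ->
    coord (e (m (i + k.*2))) a j = coord (e (m i)) a j.
  move=> jm; elim: k => [|k IH]; first by rewrite addn0.
  rewrite doubleS !addnS agree //; apply: leq_trans jm _.
  by apply: mono; rewrite ltnS leq_addr.
pose z r j := coord (e (m (r + j.*2))) a j.
have ltz r j : j < m (r + j.*2).+1.
  by rewrite (leq_trans _ (gem _)) // ltnS -addnn addnA leq_addl.
have Fz r : F a [set j | z r j].
  (* A cluster point is enough: each bit of coordinate [a] is eventually constant along the
     sequence, which forces that coordinate of [p] to be [z r]. *)
  have [p [Cp clp]] : C `&` cluster ((fun k => e (m (r + k.*2))) @ \oo) !=set0.
    apply: cC; apply: (@filterE _ \oo) => k; apply: QC; exact: (Qm _).1.
  have -> : z r = coord p a; last exact: coordP.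
  apply/funext => j.
  have near_z : ((fun k => e (m (r + k.*2))) @ \oo)
      [set q | coord q a j = z r j].
    exists j => // k /= jk; rewrite /z -(subnK jk) doubleD addnC -addnA.
    rewrite (addnC _ r) addnC; exact: stable.
  have [q [<- /(_ a j)]] := clp _ _ near_z (nbhs_coord p j.+1 (finite_set1 a)).
  exact.
exists m, [set j | z 0 j /\ z 1 j]; split=> //.
  exact: filterI (Fz 0) (Fz 1).
move=> i j /andP[_ jm] [z0 z1].
have : z (odd i) j by case: (odd i).
(* The terms [m (odd i + j.*2)] and [m i] are both compared with the later term [m (i + j.*2)]. *)
rewrite /z -(stable _ i./2 j (ltz _ _)) -addnA (addnC j.*2) addnA.
by rewrite odd_double_half stable.
Qed.


(** A basic open set sees only bits below some [N], and these are unchanged in the points of index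
    at least [N]. *)
Lemma dense_perturb (d : nat -> X) a (v : nat -> nat -> bool)
    (vF : forall n, F a [set k | v n k]) :
  dense (range d) ->
  (forall n k, k < n -> v n k = coord (d (logn 2 n)) a k) ->
  exists e : nat -> X, dense (range e) /\ forall n, coord (e n) a = v n.
Proof.
move=> dd vd.
(* Every index m is logn 2 n for arbitrarily large n. *)
pose p n b := if pselect (b = a) then v n else coord (d (logn 2 n)) b.
have pF n b : F b [set k | p n b k].
  rewrite /p; case: pselect => [ba|_] /=.
    by rewrite ba; exact: vF.
  exact: coordP.
pose e n := point_of (pF n).
exists e; split=> [|n]; last by rewrite coord_point_of /p; case: pselect.
apply/dense_coordP => q S N fS.
have [_ [m _ <-] dmq] := (dense_coordP _).1 dd q S N fS.
pose n := 2 ^ m * N.*2.+1.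
have nm : logn 2 n = m.
  rewrite /n lognM ?expn_gt0 // pfactorK // lognE /= dvdn2 /= odd_double.
  by rewrite addn0.
have Nn : N <= n.
  rewrite /n (leq_trans _ (leq_pmull _ _)) ?expn_gt0 //.
  by rewrite -addnn -addnS leq_addr.
exists (e n) => [|b k Sb kN]; first by exists n.
rewrite coord_point_of -dmq // /p nm; case: pselect => [ba|//] /=.
by rewrite ba vd ?nm //; exact: leq_trans kN Nn.
Qed.

Lemma block_selective_of_crowded a :
  omega_filter (F a) ->
  (forall E : set X, countable_dense E -> compactly_crowded E) ->
  (exists D : set X, countable_dense D) -> block_selective (F a).
Proof.
move=> oF crE [D [cD dD]] f x ltf Fx.
(* Crowdedness of [D] is used here to get a point of [D], so that [D] can be enumerated. *)
have [Q [_ [QD [q /QD Dq] _ _ _]]] := crE D (conj cD dD).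
have [d dE] := countable_range_of cD (ex_intro _ q Dq).
(* The first [n] bits are those required by [dense_perturb]; a block starting at [n] sees only the
   later ones. *)
pose v n k := if k < n then coord (d (logn 2 n)) a k
              else (f n <= k) && `[< x n k >].
have vF n : F a [set k | v n k].
  have [_ +] := oF; apply; first exact: (Fx n).
    apply: (@sub_finite_set _ _ `I_(f n)) => // k [xk /= /negP].
    rewrite ltnNge; apply: contra => fk.
    by rewrite /v ltnNge (leq_trans (ltnW (ltf n)) fk) /= fk; apply/asboolP.
  apply: (@sub_finite_set _ _ `I_n) => // k [/= vk xk].
  apply: contrapT => /negP kn; apply: xk; move: vk.
  by rewrite /v (negbTE kn) => /andP[_ /asboolP].
rewrite -dE in dD.
have vd n k : k < n -> v n k = coord (d (logn 2 n)) a k by rewrite /v => ->.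
have [e [de ev]] := dense_perturb vF dD vd.
have ce : countable (range e) by exact: card_image_le.
have [m [w [Fw fm wm]]] := filter_branches oF ltf (crE _ (conj ce de)).
exists m, w; split=> // i j mij wj; have := wm i j mij wj.
rewrite ev /v; case: ltnP => [|_ /andP[-> /asboolP]//].
by rewrite ltnNge; case/andP: mij => ->.
Qed.

End product_of_filters.

(** * Consecutive blocks of natural numbers *)

Section blocks.
Context (m : nat -> nat) (ltm : forall i, m i < m i.+1).

Lemma block_mono : {homo m : i j / i <= j}.
Proof. by apply: homo_leq => [//|? ? ?|i]; [exact: leq_trans|exact: ltnW]. Qed.

Lemma block_ge i : i <= m i.
Proof. by elim: i => // i IH; exact: leq_ltn_trans IH (ltm i). Qed.

Lemma block_le i i' j : m i <= j -> j < m i'.+1 -> i <= i'.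
Proof.
move=> ij ji'; rewrite -ltnS ltnNge; apply/negP => /block_mono.
by rewrite leqNgt (leq_ltn_trans ij ji').
Qed.

Lemma block_exists n j : m n <= j -> exists2 i, n <= i & m i <= j < m i.+1.
Proof.
move=> nj; have ex : exists i, j < m i.+1 by exists j; exact: block_ge.
case: (ex_minnP ex) => i ji imin; exists i; first exact: block_le nj ji.
rewrite ji andbT; case: i => [|i] in ji imin *.
  exact: leq_trans (block_mono (leq0n n)) nj.
by rewrite leqNgt; apply/negP => /imin; rewrite ltnn.
Qed.

Lemma block_uniq i i' j : m i <= j < m i.+1 -> m i' <= j < m i'.+1 -> i = i'.
Proof.
move=> /andP[ij ji] /andP[i'j ji']; apply/eqP.
by rewrite eqn_leq (block_le ij ji') (block_le i'j ji).
Qed.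

End blocks.

(** * Block-selective filters are non-meager P-filters *)

Lemma omega_filter_infinite G w : omega_filter G -> G w -> infinite_set w.
Proof.
move=> [FG fin] Gw finw; apply: (@filter_not_empty _ G _).
by apply: fin Gw _ _; rewrite ?setD0 // set0D.
Qed.

(** Select for the finite intersections of an enumeration of [Y]: beyond [m n], [w] meets only
    blocks [i >= n], where it lies in [x (m i)], hence in [u n] because [n <= m i]. *)
Lemma block_selective_P_filter G :
  omega_filter G -> block_selective G -> P_filter G.
Proof.
move=> oG selG; split=> // Y YG cY; have [FG _] := oG.
(* Adjoining [setT] covers the case of empty [Y]. *)
have [u uE] : exists u : nat -> set nat, range u = Y `|` [set setT].
  apply: countable_range_of; last by exists setT; right.
  exact/countable_setU/countable1.
have Gu n : G (u n).
  have : range u (u n) by exists n.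
  by rewrite uE => -[/YG//|->]; exact: filterT.
pose x n := \bigcap_(i in `I_n.+1) u i.
have Gx n : G (x n) by apply: filter_finite_bigcap.
have [m [w [Gw fm wm]]] := selG S x (fun n => ltnSn _) Gx.
exists w => //; split=> [|y Yy]; first exact: omega_filter_infinite Gw.
have [n _ uy] : range u y by rewrite uE; left.
apply: (@sub_finite_set _ _ `I_(m n)) => // j [wj nyj].
rewrite /= ltnNge; apply/negP => /(block_exists fm) [i ni mij]; apply: nyj.
rewrite -uy; have [_] := wm i j mij wj; apply => /=.
by rewrite ltnS (leq_trans ni) // block_ge.
Qed.

Lemma nbhs_cylinder (x : cantor_space) (U : set cantor_space) :
  nbhs x U <->
  exists l, [set y : cantor_space | forall k, k < l -> y k = x k] `<=` U.
Proof.
pose cyl l := [set y : cantor_space | forall k, k < l -> y k = x k].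
split=> [|[l lU]]; last first.
  have /cvg_cantorP near_x : nbhs x --> x by [].
  have : nbhs x (\bigcap_(k in `I_l) [set y | y k = x k]).
    by apply: filter_finite_bigcap => // k _; exact: near_x.
  by apply: filterS.
have FG : Filter (filter_from setT cyl).
  apply: filter_from_filter; first by exists 0.
  move=> l l' _ _; exists (maxn l l') => // y xy.
  by split=> k kl; apply: xy; rewrite leq_max kl ?orbT.
have Gx : filter_from setT cyl --> x.
  by apply/cvg_cantorP => k; exists k.+1 => // y; exact.
by move=> /Gx [l _ lU]; exists l.
Qed.

Lemma nowhere_dense_extend (N : set cantor_space) (u : nat -> bool) l :
  nowhere_dense N -> exists (t : nat -> bool) l', [/\ l <= l',
    forall k, k < l -> t k = u k &
    forall v : cantor_space, (forall k, k < l' -> v k = t k) -> ~ N v].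
Proof.
move=> ndN.
have [y yu yN] : exists2 y : cantor_space,
    forall k, k < l -> y k = u k & ~ closure N y.
  apply: contrapT => H; have : (closure N)° u.
    apply/nbhs_cylinder; exists l => y yu.
    by apply: contrapT => yN; apply: H; exists y.
  by rewrite ndN.
have : nbhs y (~` closure N).
  by apply: open_nbhs_nbhs; split => //; apply/closed_openC/closed_closure.
move=> /nbhs_cylinder [l' l'N]; exists y, (maxn l l'); split=> //.
  exact: leq_maxl.
move=> v vy /subset_closure; apply: l'N => k kl'.
by apply: vy; rewrite leq_max kl' orbT.
Qed.

(** There are finitely many pairs of an [n]-bit prefix and an index [i <= n]. Treating them one
    after another, each time extending the pattern to leave [N i], gives a pattern that works for
    all prefixes. *)
Lemma nowhere_dense_block (N : nat -> set cantor_space) n :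
  (forall i, nowhere_dense (N i)) ->
  exists tl : (nat -> bool) * nat, n < tl.2 /\
    forall v : cantor_space, (forall k, n <= k < tl.2 -> v k = tl.1 k) ->
    forall i, i <= n -> ~ N i v.
Proof.
move=> ndN.
have ext (L : seq (n.-tuple bool * nat)) : exists (t : nat -> bool) l, n < l /\
    forall v : cantor_space, (forall k, n <= k < l -> v k = t k) ->
    forall p, p \in L -> (forall k : 'I_n, v k = tnth p.1 k) -> ~ N p.2 v.
  elim: L => [|[s i] L [t [l [nl tl]]]]; first by exists (fun=> true), n.+1.
  (* The prefix [s] is placed below [n] and the pattern built so far above it; the extension of [u]
     keeps that pattern on [[n, l)]. *)
  pose u k := if k < n then nth true s k else t k.
  have [t' [l' [ll' t'u t'N]]] := nowhere_dense_extend u l (ndN i).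
  exists t', l'; split=> [|v vt p]; first exact: leq_trans nl ll'.
  rewrite inE => /predU1P [-> /= vs|pL vp].
    apply: t'N => k kl'; case: (ltnP k n) => [kn|nk].
      rewrite t'u ?(ltn_trans kn) // /u kn (vs (Ordinal kn)).
      by rewrite (tnth_nth true).
    by apply: vt; rewrite nk.
  apply: (tl v) => // k /andP[nk kl]; rewrite vt ?nk ?(leq_trans kl) //.
  by rewrite t'u // /u ltnNge nk.
have [t [l [nl tN]]] :=
  ext [seq (s, i) | s <- enum {: n.-tuple bool}, i <- iota 0 n.+1].
exists (t, l); split=> // v vt i lein.
apply: (tN v vt ([tuple v k | k < n], i)) => [|k]; last by rewrite tnth_mktuple.
by apply/allpairsP; exists ([tuple v k | k < n], i); rewrite mem_enum mem_iota.
Qed.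

(** Let [f n] be the end of the avoiding pattern that starts at [n]. Copying these patterns into the
    gaps of [w] yields a superset of [w], still in [G], that lies in no [N i]. *)
Lemma block_selective_nonmeager G :
  omega_filter G -> block_selective G -> nonmeager_filter G.
Proof.
move=> oG selG; split=> // -[N ndN GN]; have [FG _] := oG.
have [tl tlP] := choice (fun n => @nowhere_dense_block N n ndN).
have [m [w [Gw fm wm]]] :=
  selG (fun n => (tl n).2) (fun=> setT) (fun n => (tlP n).1) (fun=> filterT).
have ltm i : m i < m i.+1 by exact: leq_trans (tlP _).1 (fm i).
pose v k := `[< w k \/ exists i, m i <= k < (tl (m i)).2 /\ (tl (m i)).1 k >].
have : char_funs G v by apply: filterS Gw => k wk; apply/asboolP; left.
rewrite GN => -[i _].
apply: ((tlP (m i)).2 v) => [k /andP[mk kt]|]; last exact: block_ge.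
have mki : m i <= k < m i.+1 by rewrite mk (leq_trans kt).
(* In the gap of block [i], [w] is empty, and by disjointness of the blocks only the pattern of that
   block contributes. *)
apply/asboolP/idP => [[wk|[i' [/andP[mk' kt']]]]|tk].
- by have [] := wm i k mki wk; rewrite leqNgt kt.
- by rewrite (block_uniq ltm mki (i' := i')) // mk' (leq_trans kt').
- by right; exists i; rewrite mk kt.
Qed.

(** * Transfer along homeomorphisms, and crowded sets from Cantor sets *)

Lemma countable_dense_homogeneous_transfer (T : topologicalType)
    (P : set T -> Prop) :
  countable_dense_homogeneous T ->
  (forall h D, homeomorphism h -> P D -> P (h @` D)) ->
  (forall D D', D `<=` D' -> P D -> P D') ->
  (exists2 A, countable A & P A) ->
  forall E, countable_dense E -> P E.
Proof.
move=> [[D [cD dD]] cdh] homP monoP [A cA PA] E cdE.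
(* The witness [A] need not be dense; its union with [D] is, and some homeomorphism carries that
   union onto [E]. *)
have cdA : countable_dense (A `|` D).
  split; last first.
    move=> O O0 oO; have [x [Ox Dx]] := dD O O0 oO.
    by exists x; split=> //; right.
  exact: countable_setU.
have [h hh <-] := cdh _ _ cdA cdE.
by apply: homP hh _; apply: monoP PA; exact: subsetUl.
Qed.

Lemma compactly_crowded_homeomorphism (T : topologicalType) (h : T -> T) D :
  homeomorphism h -> compactly_crowded D -> compactly_crowded (h @` D).
Proof.
move=> [ch [k [_ hk _]]] [Q [C [QD [q Qq] Qlim cC QC]]].
exists (h @` Q), (h @` C); split.
- exact: image_subset.
- by exists (h q); exists q.
- move=> _ [x Qx <-] U /ch hU; have [y [yx Qy Uy]] := Qlim _ Qx _ hU.
  by exists (h y); split=> //; rewrite (inj_eq (can_inj hk)).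
- by apply: continuous_compact => //; exact: continuous_subspaceT.
- exact: image_subset.
Qed.

Lemma compactly_crowdedS (T : topologicalType) (D D' : set T) :
  D `<=` D' -> compactly_crowded D -> compactly_crowded D'.
Proof.
move=> DD' [Q [C [QD Q0 Qlim cC QC]]]; exists Q, C; split=> //.
exact: subset_trans QD DD'.
Qed.

(** The eventually false sequences are countable and crowded in Cantor space, whose image under
    [phi] is compact. *)
Lemma embedded_cantor_crowded (T : topologicalType) (phi : cantor_space -> T) :
  continuous phi -> injective phi ->
  exists2 A : set T, countable A & compactly_crowded A.
Proof.
move=> cphi iphi.
pose Q := range (fun s : seq bool => phi (fun k => nth false s k)).
exists Q.
  exact: card_le_trans (card_image_le _ _) (countableP _).
exists Q, (range phi); split=> //.
- by exists (phi (fun k => nth false [::] k)); exists [::].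
- move=> _ [s _ <-] U /cphi /nbhs_cylinder [l lU].
  (* Pad [s] with [false] up to length at least [l], then append [true]: the first [l] bits are
     kept, but the point changes. *)
  pose s' := mkseq (fun k => if k < maxn l (size s) then nth false s k else true)
    (maxn l (size s)).+1.
  have s'E k : k < maxn l (size s) -> nth false s' k = nth false s k.
    by move=> kl; rewrite nth_mkseq ?kl // ltnS ltnW.
  have s'l : nth false s' (maxn l (size s)) by rewrite nth_mkseq ?ltnn.
  exists (phi (fun k => nth false s' k)); split; first last.
  + by apply: lU => k kl; rewrite s'E // leq_max kl.
  + by exists s'.
  + apply/eqP => /iphi /(congr1 (fun f => f (maxn l (size s)))).
    by rewrite s'l nth_default // leq_maxr.
- by apply: continuous_compact cantor_space_compact; exact: continuous_subspaceT.
- by move=> _ [s _ <-]; exists (fun k => nth false s k).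
Qed.

Lemma infinite_set_injection (T : Type) : infinite_set [set: T] ->
  exists g : nat -> T, injective g.
Proof.
elim/Ppointed: T => T; first by rewrite emptyE => /(_ (finite_set0 _)).
move=> /infiniteP/pcard_injP [g gi].
by exists g => m n; apply: gi; rewrite inE.
Qed.

(** * Crowded subsets and block selection in a homogeneous product *)

Section crowded_subsets.
Context {K : Type} (F : K -> set (set nat)) (oF : forall a, omega_filter (F a)).

Local Notation X := (prod_topology (fun a : K => filter_space (F a))).

Lemma cantor_product_continuous (phi : cantor_space -> X) :
  (forall a k, exists i, forall c c', c i = c' i ->
    coord (phi c) a k = coord (phi c') a k) -> continuous phi.
Proof.
move=> phiP c; apply/cvg_coordP => a k; have [i iP] := phiP a k.
have /cvg_cantorP near_c : nbhs c --> c by [].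
by have := near_c i; apply: filterS => c' /iP.
Qed.

Lemma omega_filter_cofinite a (x : set nat) : finite_set (~` x) -> F a x.
Proof.
move=> fx; have [FF fin] := oF a.
apply: (fin setT); [exact: filterT|by rewrite setTD|].
by rewrite setDT; exact: finite_set0.
Qed.

(** All supersets of [x] belong to [F a]; adding to [x] arbitrary parts of an infinite sequence
    outside it gives a Cantor set in coordinate [a]. *)
Lemma crowded_of_coinfinite a (x : set nat) : F a x -> infinite_set (~` x) ->
  exists2 A : set X, countable A & compactly_crowded A.
Proof.
move=> Fx /infiniteP/pcard_leP[g]; have [FF _] := oF a.
have gx n : (~` x) (g n) by apply: (@funS _ _ [set: nat] _ g).
have gi : injective g by move=> m n; apply: inj; rewrite inE.
pose p (c : cantor_space) b k :=
  if pselect (b = a) then `[< x k \/ exists2 i, g i = k & c i >] else true.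
have pF c b : F b [set k | p c b k].
  rewrite /p; case: pselect => [ba|_] /=.
    rewrite ba; apply: filterS Fx => k xk /=; apply/asboolP; by left.
  by have [FFb _] := oF b; apply: filterS filterT.
apply: (@embedded_cantor_crowded X (fun c => point_of (pF c))).
  apply: cantor_product_continuous => b k.
  have [[i gik]|ngk] := pselect (exists i, g i = k).
    exists i => c c' cc'; rewrite !coord_point_of /p; case: pselect => //= _.
    congr asbool; apply/propext; split=> -[xk|[j]]; [by left| |by left|];
      by rewrite -gik => /gi -> ci; right; exists i => //; rewrite ?cc' // -cc'.
  exists 0 => c c' _; rewrite !coord_point_of /p; case: pselect => //= _.
  by congr asbool; apply/propext; split=> -[xk|[j gjk]]; [by left| |by left|];
    case: ngk; exists j.
move=> c c' cc'; apply/funext => i.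
have : coord (point_of (pF c)) a (g i) = coord (point_of (pF c')) a (g i).
  by rewrite cc'.
rewrite !coord_point_of /p; case: pselect => //= _.
have E (d : nat -> bool) : `[< x (g i) \/ exists2 j, g j = g i & d j >] = d i.
  by apply/asboolP/idP => [[/gx//|[j /gi ->]]//|di]; right; exists i.
by rewrite !E.
Qed.

(** Toggling bit 0 independently in countably many coordinates gives a Cantor set, all of whose
    coordinates are cofinite. *)
Lemma crowded_of_infinite : infinite_set [set: K] ->
  exists2 A : set X, countable A & compactly_crowded A.
Proof.
move=> infK.
have [g gi] := infinite_set_injection infK.
pose p (c : cantor_space) b k := (0 < k) || `[< exists2 i, g i = b & c i >].
have pF c b : F b [set k | p c b k].
  apply: omega_filter_cofinite; apply: (@sub_finite_set _ _ [set 0]) => //.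
  by move=> k /= /negP; rewrite /p negb_or -eqn0Ngt => /andP[/eqP].
have p0 c i : p c (g i) 0 = c i.
  by rewrite /p /=; apply/asboolP/idP => [[j /gi ->]//|ci]; exists i.
apply: (@embedded_cantor_crowded X (fun c => point_of (pF c))).
  apply: cantor_product_continuous => b k.
  have [[i gib]|ngb] := pselect (exists i, g i = b).
    exists i => c c' cc'; rewrite !coord_point_of -gib.
    by case: k => [|k //]; rewrite !p0.
  exists 0 => c c' _; rewrite !coord_point_of /p; congr (_ || asbool _).
  by apply/propext; split=> -[j gjb]; case: ngb; exists j.
move=> c c' cc'; apply/funext => i; rewrite -(p0 c i) -(p0 c' i).
have : coord (point_of (pF c)) (g i) 0 = coord (point_of (pF c')) (g i) 0.
  by rewrite cc'.
by rewrite !coord_point_of.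
Qed.

(** A point is coded by the finite complements of its finitely many coordinates. *)
Lemma countable_product : finite_set [set: K] ->
  (forall a x, F a x -> finite_set (~` x)) -> countable [set: X].
Proof.
move=> /(@finite_seqP {classic K}) [s sE] finF.
apply/pcard_injP.
pose co (p : X) b : {fset nat} := fset_set (~` [set k | coord p b k]).
exists (fun p => choice.pickle [seq enum_fset (co p b) | b <- s]) => p q _ _.
move=> /(pcan_inj choice.pickleK) /(@eq_in_map {classic K} _) pq.
apply: eq_coord => b k.
have bs : b \in (s : seq {classic K}) by have : [set: K] b by []; rewrite sE.
have := congr1 (fun A : {fset nat} => [set` A]) (val_inj (pq b bs)).
rewrite /co !fset_setK; try by apply: (finF b); exact: coordP.
by move=> /setC_inj /(congr1 (fun A => A k)) /= E; apply/idP/idP; rewrite E.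
Qed.

(** Otherwise the whole space and the complement of a point are both countable dense, but a
    bijection cannot map the first onto the second. The index [a] excludes the one-point product. *)
Lemma uncountable_of_cdh (a : K) : countable_dense_homogeneous X ->
  ~ countable [set: X].
Proof.
move=> [_ cdh] cX.
have p0F b : F b [set k | xpredT k].
  by by have [FF _] := oF b; apply: filterS filterT.
pose p0 : X := point_of p0F.
have [||h [_ [k [_ hk kh]]] hE] := cdh [set: X] [set~ p0].
- by split=> // O [x Ox] _; exists x.
- split; first exact: sub_countable (subset_card_le (@subsetT _ _)) cX.
  apply/dense_coordP => p S N fS.
  (* Bit [N] is turned off so that the approximation of [p] differs from the all-true point [p0]. *)
  pose p' b j := if j < N then coord p b j else ~~ (j == N).
  have p'F b : F b [set j | p' b j].
    apply: omega_filter_cofinite; apply: (@sub_finite_set _ _ `I_N.+1) => // j.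
    move=> /= /negP; rewrite /p' ltnS; case: ltnP => [/ltnW //|Nj].
    by rewrite negbK => /eqP ->.
  exists (point_of p'F) => [/= E|b j _ jN]; last by rewrite coord_point_of /p' jN.
  have : coord (point_of p'F) a N = coord p0 a N by rewrite E.
  by rewrite !coord_point_of /p' ltnn eqxx.
have : range h p0 by exists (k p0).
by rewrite hE; apply.
Qed.

(** If [K] is finite and no filter has a coinfinite member, the product is countable, which
    homogeneity excludes. *)
Lemma crowded_of_cdh (a : K) : countable_dense_homogeneous X ->
  exists2 A : set X, countable A & compactly_crowded A.
Proof.
move=> cdh.
have [finK|] := pselect (finite_set [set: K]); last exact: crowded_of_infinite.
apply: contrapT => H; apply: (uncountable_of_cdh a cdh).
apply: countable_product => // b x Fx; apply: contrapT => cox.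
by apply: H; exact: crowded_of_coinfinite Fx cox.
Qed.

Lemma block_selective_of_cdh (a : K) :
  countable_dense_homogeneous X -> block_selective (F a).
Proof.
move=> cdh; apply: block_selective_of_crowded => //; last by case: cdh.
apply: (countable_dense_homogeneous_transfer cdh).
- exact: compactly_crowded_homeomorphism.
- exact: compactly_crowdedS.
- exact: crowded_of_cdh.
Qed.

End crowded_subsets.

(** * Convergent sequences and the bound on the number of factors *)

Lemma card_le_total (T U : Type) (A : set T) (B : set U) :
  A #<= B \/ B #<= A.
Proof.
(* Copies in the sum type make both sets subsets of one type, so that [exists_card_min] applies to
   the pair. *)
pose A' := [set (inl t : T + U) | t in A].
pose B' := [set (inr u : T + U) | u in B].
have AA' : A' #= A by apply: inj_card_eq => x y _ _ [].
have BB' : B' #= B by apply: inj_card_eq => x y _ _ [].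
have [|X [->|->] Xmin] := @exists_card_min (T + U) [set A'; B'].
- by exists A'; left.
- left; have := Xmin B' (or_intror erefl).
  by rewrite (card_le_eql AA') (card_le_eqr BB').
- right; have := Xmin A' (or_introl erefl).
  by rewrite (card_le_eql BB') (card_le_eqr AA').
Qed.

Definition contains_convergent_sequence (T : topologicalType) (D : set T) :=
  exists (s : nat -> T) (p : T), [/\ injective s, range s `<=` D & s @ \oo --> p].

Lemma contains_convergent_sequence_homeomorphism (T : topologicalType)
    (h : T -> T) D :
  homeomorphism h -> contains_convergent_sequence D ->
  contains_convergent_sequence (h @` D).
Proof.
move=> [ch [k [_ hk _]]] [s [p [si sD sp]]].
exists (h \o s), (h p); split; first exact: inj_comp (can_inj hk) si.
  by move=> _ [n _ <-]; exists (s n) => //; apply: sD; exists n.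
exact: (cvg_comp _ _ sp (ch p)).
Qed.

Lemma contains_convergent_sequenceS (T : topologicalType) (D D' : set T) :
  D `<=` D' -> contains_convergent_sequence D -> contains_convergent_sequence D'.
Proof.
move=> DD' [s [p [si sD sp]]]; exists s, p; split=> //.
exact: subset_trans sD DD'.
Qed.

Lemma infinite_set_ge (A : set nat) n : infinite_set A -> exists2 k, A k & n <= k.
Proof.
move=> infA; apply: contrapT => H; apply: infA.
apply: (@sub_finite_set _ _ `I_n) => // k Ak /=.
by rewrite ltnNge; apply/negP => nk; apply: H; exists k.
Qed.

Section convergent_sequences.
Context {K : Type} (F : K -> set (set nat)) (oF : forall a, omega_filter (F a)).

Local Notation X := (prod_topology (fun a : K => filter_space (F a))).

(** The points whose coordinates all omit just [n] converge to the point with all coordinates full;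
    coordinate [a] tells them apart. *)
Lemma product_convergent_sequence (a : K) :
  exists2 A : set X, countable A & contains_convergent_sequence A.
Proof.
have F1 (n : nat) b : F b [set k | k != n].
  apply: omega_filter_cofinite => //; apply: (@sub_finite_set _ _ [set n]) => //.
  by move=> k /= /negP; rewrite negbK => /eqP.
have F0 b : F b [set k | xpredT k].
  by have [FF _] := oF b; apply: filterS filterT.
pose s n : X := point_of (F1 n).
exists (range s); first exact: card_image_le.
exists s, (point_of F0); split=> [m n mn|//|].
  have : coord (s m) a m = coord (s n) a m by rewrite mn.
  by rewrite !coord_point_of eqxx => /esym /negbFE /eqP.
apply/cvg_coordP => b k; exists k.+1 => // n /= kn.
by rewrite !coord_point_of; apply/eqP => E; rewrite E ltnn in kn.
Qed.

Lemma dense_without_convergent_sequence (g : K -> set nat) :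
  frakp `<=` range g -> (exists D : set X, countable_dense D) ->
  exists2 E : set X, countable_dense E & ~ contains_convergent_sequence E.
Proof.
move=> gp [D [cD dD]].
have [[fip nopi] _] := frakpP.
have F0 b : F b [set k | xpredT k].
  by have [FF _] := oF b; apply: filterS filterT.
have [q [_ Dq]] := dD setT (ex_intro _ (point_of F0 : X) I) openT.
have [d dE] := countable_range_of cD (ex_intro _ q Dq).
rewrite -{}dE {q Dq cD} in dD.
(* The range of [g] may exceed [frakp]; replacing the extra values by [setT] keeps finite
   intersections infinite. *)
pose y b : set nat := if pselect (frakp (g b)) then g b else setT.
have y_infinite (S : set K) : finite_set S -> infinite_set (\bigcap_(b in S) y b).
  move=> fS; have : infinite_set (\bigcap_(z in (y @` S) `&` frakp) z).
    by apply: fip => //; apply: finite_setIl; exact: finite_image.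
  apply: sub_infinite_set => k kz b Sb; rewrite /y.
  case: pselect => //= gb; have := kz (y b); rewrite /y; case: pselect => //= gb'.
  by apply; split=> //; exists b => //; rewrite /y; case: pselect.
(* Otherwise [A] would be a pseudointersection of [frakp]. *)
have y_nopi (A : set nat) : infinite_set A -> exists b, infinite_set (A `\` y b).
  move=> infA; apply: contrapT => H; apply: nopi; exists A; split=> // x px.
  have [b _ gb] := gp x px.
  apply: contrapT => infAx; apply: H; exists b.
  by rewrite /y gb; case: pselect.
pose c n k b j := if `[< y b k >] then coord (d n) b j else k <= j.
have cF n k b : F b [set j | c n k b j].
  rewrite /c; case: asboolP => _; first exact: coordP.
  apply: omega_filter_cofinite => //; apply: (@sub_finite_set _ _ `I_k) => //.
  by move=> j /= /negP; rewrite -ltnNge.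
pose e n k : X := point_of (cF n k).
(* The bound [n <= k] leaves finitely many points for each [k], so an injective sequence in this set
   uses infinitely many values of [k]. *)
exists [set x | exists n k, n <= k /\ x = e n k].
  split.
    apply: (@sub_countable _ _ _ (range (fun nk : nat * nat => e nk.1 nk.2))).
      by apply: subset_card_le => x [n [k [_ ->]]]; exists (n, k).
    exact: card_le_trans (card_image_le _ _) (countableP _).
  apply/dense_coordP => p S N fS.
  have [_ [n _ <-] dp] := (dense_coordP _).1 dD p S N fS.
  have [k yk nk] := infinite_set_ge n (y_infinite S fS).
  exists (e n k) => [|b j Sb jN]; first by exists n, k.
  by rewrite coord_point_of /c; case: asboolP => [_|[]]; [exact: dp|exact: yk].
move=> [s [p [si sE sp]]].
have /choice [nk nkP] j : exists nk : nat * nat, nk.1 <= nk.2 /\ s j = e nk.1 nk.2.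
  by have [|n [k nkE]] := sE (s j); [exists j|exists (n, k)].
have inf_k : infinite_set (range (fun j => (nk j).2)).
  move=> fk; apply: infinite_nat.
  have [M kM] : exists M, forall j, (nk j).2 < M.
    have [r rE] := (finite_seqP _).1 fk; exists (\max_(i <- r) i).+1 => j.
    rewrite ltnS; apply: (@leq_bigmax_seq _ r xpredT id) => //.
    by have : range (fun j => (nk j).2) (nk j).2 by [exists j]; rewrite rE.
  have : finite_set (range s).
    apply: (@sub_finite_set _ _
      ((fun nk : nat * nat => e nk.1 nk.2) @` (`I_M `*` `I_M))).
      move=> _ [j _ <-]; exists (nk j); last by rewrite (nkP j).2.
      by split; [exact: leq_ltn_trans (nkP j).1 (kM j)|exact: kM].
    by apply: finite_image; exact: finite_setX.
  move=> /(@finite_preimage _ _ _ s (in2W si)); apply: sub_finite_set.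
  by move=> j _; exists j.
have [b inf_b] := y_nopi _ inf_k.
have [FF _] := oF b; apply: (@filter_not_empty _ (F b) _).
rewrite (_ : set0 = [set k | coord p b k]); first exact: coordP.
symmetry; rewrite -subset0 => l /=.
have /cvg_coordP /(_ b l) [N _ Nl] := sp.
(* Removing the values of [k] used before stage [N] forces the chosen term to be late enough to
   share bit [l] with the limit. *)
have : infinite_set ((range (fun j => (nk j).2) `\` y b)
    `\` ((fun j => (nk j).2) @` `I_N)).
  by apply: infinite_setD => //; exact: finite_image.
move=> /(infinite_set_ge l.+1) [_ [[[j _ <-] nyj] nj] lj].
rewrite -(Nl j); last first.
  by rewrite /= leqNgt; apply/negP => jN; apply: nj; exists j.
rewrite (nkP j).2 coord_point_of /c; case: asboolP => // _.
by rewrite leqNgt lj.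
Qed.

Lemma card_index_of_cdh : countable_dense_homogeneous X ->
  card_lt [set: K] frakp.
Proof.
move=> cdh.
have nle : ~ (frakp #<= [set: K]).
  move=> /pcard_surjP [g gp].
  have [[_ nopi] _] := frakpP.
  (* If [K] were empty, so would be [frakp], and every infinite set would be a pseudointersection of
     it. *)
  have [a _] : [set: K] !=set0.
    apply: contrapT => K0; apply: nopi; exists setT.
    split=> [|x /gp [a _ _]]; first exact: infinite_nat.
    by case: K0; exists a.
  have [E cdE] := dense_without_convergent_sequence gp cdh.1.
  apply; apply: (countable_dense_homogeneous_transfer cdh) cdE.
  - exact: contains_convergent_sequence_homeomorphism.
  - exact: contains_convergent_sequenceS.
  - exact: product_convergent_sequence.
apply/andP; split; last exact/negP.
by case: (card_le_total [set: K] frakp).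
Qed.

End convergent_sequences.

Theorem theorem5p1 (K : Type) (F : K -> set (set nat))
  (filterF : forall a : K, omega_filter (F a))
  (cdhF : countable_dense_homogeneous
            (prod_topology (fun a : K => filter_space (F a)))) :
  card_lt [set: K] frakp /\
  forall a : K, nonmeager_filter (F a) /\ P_filter (F a).
Proof.
split=> [|a]; first exact: card_index_of_cdh cdhF.
have selF := block_selective_of_cdh filterF cdhF (a := a).
by split; [exact: block_selective_nonmeager|exact: block_selective_P_filter].
Qed.
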